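(* Let $X$ be a Banach space, let $A,B,C,D\in\mathcal L(X)$ and let $M=\begin{bmatrix}A&B\\ C&D\end{bmatrix}\in M_2(\mathcal L(X))$. Suppose that $A$ and $D$ have Hirano inverses. If $BD^H=0$, $A^{\pi}BC=0$, $A^HBC=0$ and $(DD^{\pi}-CA^HB)C=0$, then $M\in M_2(\mathcal L(X))^H$, i.e. $M$ has Hirano inverse in $M_2(\mathcal L(X))$.
   Context: $\mathcal L(X)$ is the Banach algebra of all bounded linear operators on the Banach space $X$; $I$ is the identity operator. $M_2(\mathcal L(X))$ is the algebra of $2\times 2$ matrices over $\mathcal L(X)$ (bounded operators on $X\oplus X$). Let $\mathcal R$ be $\mathcal L(X)$ or $M_2(\mathcal L(X))$ and $T\in\mathcal R$. - $T$ has Hirano inverse if there is $Z\in\mathcal R$ with $TZ=ZT$, $Z=ZTZ$ and $T^2-TZ$ nilpotent; such $Z$ is unique if it exists and is denoted $T^H$. $\mathcal R^H$ denotes the set of elements of $\mathcal R$ having Hirano inverse. - $T^{\pi}=I-TT^D$, where $T^D$ is the Drazin inverse of $T$ (the unique $Z$ with $TZ=ZT$, $Z=ZTZ$, $T-T^2Z$ nilpotent). If $T$ has Hirano inverse then $T^D=T^H$, so $T^{\pi}=I-TT^H$. *)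

(* Defs.v *)
From HB Require Import structures.
From mathcomp Require Import all_boot all_order all_algebra.
From mathcomp Require Import boolp classical_sets topology normedtype.

Set Implicit Arguments.
Unset Strict Implicit.
Unset Printing Implicit Defensive.

Import Order.TTheory GRing.Theory Num.Theory.
Import numFieldNormedType.Exports.

Local Open Scope classical_set_scope.
Local Open Scope ring_scope.

Section RingInverses.
Variable R : pzRingType.
Implicit Types T Z W : R.

Definition nilpotent (T : R) : Prop := exists n : nat, T ^+ n = 0.

Definition is_drazin_inverse (T Z : R) : Prop :=
  [/\ T * Z = Z * T, Z = Z * T * Z & nilpotent (T - T ^+ 2 * Z)].

Definition is_hirano_inverse (T Z : R) : Prop :=
  [/\ T * Z = Z * T, Z = Z * T * Z & nilpotent (T ^+ 2 - T * Z)].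

Definition has_hirano_inverse (T : R) : Prop :=
  exists Z : R, is_hirano_inverse T Z.

(* [drazin_inverse] and [hirano_inverse] are total; they take the junk value 0
   at elements that have no such inverse. *)
Definition drazin_inverse (T : R) : R := xget 0 (is_drazin_inverse T).
Definition hirano_inverse (T : R) : R := xget 0 (is_hirano_inverse T).

Definition spectral_idempotent (T : R) : R := 1 - T * drazin_inverse T.

Lemma expr_idem_compl T Z n : T * Z = Z * T -> Z = Z * T * Z ->
  (T - T ^+ 2 * Z) ^+ n.+1 = T ^+ n.+1 * (1 - T * Z).
Proof.
move=> cTZ ZTZ; have -> : T - T ^+ 2 * Z = T * (1 - T * Z).
  by rewrite mulrBr mulr1 mulrA expr2.
have cTe : GRing.comm T (1 - T * Z).
  by apply: commrB; [exact: commr1|rewrite /GRing.comm {1}cTZ mulrA].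
have idem : (1 - T * Z) * (1 - T * Z) = 1 - T * Z.
  have TZTZ : T * Z * (T * Z) = T * Z by rewrite mulrA -(mulrA T Z T) -mulrA -ZTZ.
  by rewrite mulrBr mulr1 mulrBl mul1r TZTZ subrr subr0.
rewrite exprMn_comm//; congr (_ * _); elim: n => [|n IHn]; first by rewrite expr1.
by rewrite exprS IHn.
Qed.

Lemma drazin_inverse_unique T Z W :
  is_drazin_inverse T Z -> is_drazin_inverse T W -> Z = W.
Proof.
move=> [cTZ ZTZ [m nilZ]] [cTW WTW [n nilW]].
pose k := (m + n)%N.
have TkZ : T ^+ k.+1 = T ^+ k.+1 * (T * Z).
  apply/eqP; rewrite -subr_eq0 -{1}[T ^+ _]mulr1 -mulrBr -expr_idem_compl//.
  by rewrite /k -addnS exprD nilZ mul0r.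
have TkW : T ^+ k.+1 = T ^+ k.+1 * (T * W).
  apply/eqP; rewrite -subr_eq0 -{1}[T ^+ _]mulr1 -mulrBr -expr_idem_compl//.
  by rewrite /k -addSn exprD nilW mulr0.
have Zpow j : Z = Z ^+ j.+1 * T ^+ j.
  elim: j => [|j IHj]; first by rewrite expr1 mulr1.
  rewrite exprS -mulrA (exprSr T) (mulrA (Z ^+ _)) -IHj -cTZ mulrA.
  by rewrite -ZTZ.
have Wpow j : W = T ^+ j * W ^+ j.+1.
  elim: j => [|j IHj]; first by rewrite expr1 mul1r.
  rewrite (exprSr W) mulrA exprS -(mulrA T) -IHj cTW.
  exact: WTW.
have -> : Z = Z * T * W by rewrite {1}(Zpow k.+1) TkW mulrA -Zpow mulrA.
rewrite [RHS](Wpow k.+1) TkZ.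
have -> : T ^+ k.+1 * (T * Z) = Z * T * T ^+ k.+1.
  have cTe : GRing.comm (T * Z) T by rewrite /GRing.comm {2}cTZ mulrA.
  by rewrite -cTZ (commrX _ cTe).
by rewrite -[in RHS](mulrA (Z * T)) -Wpow.
Qed.

Lemma hirano_drazin T Z : is_hirano_inverse T Z -> is_drazin_inverse T Z.
Proof.
move=> [cTZ ZTZ [n nilH]]; split=> //; exists (2 * n).+1.
have idem : T * Z * (T * Z) = T * Z.
  by rewrite -mulrA (mulrA Z) -ZTZ.
have cTe : GRing.comm T (T * Z) by rewrite /GRing.comm {1}cTZ mulrA.
have cTH : GRing.comm (T ^+ 2) (T ^+ 2 - T * Z).
  by apply: commrB => //; exact/commr_sym/commrX/commr_sym.
have He : T ^+ 2 * (1 - T * Z) = (T ^+ 2 - T * Z) * (1 - T * Z).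
  by rewrite [RHS]mulrBl (mulrBr (T * Z)) mulr1 idem subrr subr0.
have powH j : T ^+ (2 * j) * (1 - T * Z) = (T ^+ 2 - T * Z) ^+ j * (1 - T * Z).
  elim: j => [|j IHj]; first by rewrite muln0 !expr0.
  by rewrite mulnS exprD -mulrA IHj mulrA (commrX j cTH) -mulrA He mulrA -exprSr.
by rewrite expr_idem_compl// exprS -mulrA powH nilH mul0r mulr0.
Qed.

Lemma hirano_inverse_unique T Z W :
  is_hirano_inverse T Z -> is_hirano_inverse T W -> Z = W.
Proof.
by move=> /hirano_drazin TZ /hirano_drazin; exact: drazin_inverse_unique.
Qed.

Lemma hirano_inverseE T Z : is_hirano_inverse T Z -> hirano_inverse T = Z.
Proof.
by move=> TZ; apply: (hirano_inverse_unique _ TZ); exact: (xgetI _ TZ).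
Qed.

Lemma drazin_inverseE T Z : is_drazin_inverse T Z -> drazin_inverse T = Z.
Proof.
by move=> TZ; apply: (drazin_inverse_unique _ TZ); exact: (xgetI _ TZ).
Qed.

Lemma drazin_inverse_hirano T :
  has_hirano_inverse T -> drazin_inverse T = hirano_inverse T.
Proof.
move=> [Z TZ]; rewrite (hirano_inverseE TZ).
exact/drazin_inverseE/hirano_drazin.
Qed.

End RingInverses.

Section BoundedOperators.
Variables (K : numFieldType) (X : normedModType K).

Definition bounded_operator (f : X -> X) : Prop :=
  exists2 c : K, 0 <= c & forall x, `|f x| <= c * `|x|.

Record operator := Operator {
  operator_fun :> X -> X;
  operator_linear : linear operator_fun;
  operator_bounded : bounded_operator operator_fun }.

HB.instance Definition _ := gen_eqMixin operator.
HB.instance Definition _ := gen_choiceMixin operator.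

HB.instance Definition _ (T : operator) :=
  GRing.isLinear.Build K X X *:%R T (@operator_linear T).

Lemma operatorP (S T : operator) : S =1 T -> S = T.
Proof.
case: S T => [f fl fb] [g gl gb] /= /funext fg.
by subst g; congr Operator; exact: Prop_irrelevance.
Qed.

Lemma bounded_operator_continuous (f : {linear X -> X}) :
  bounded_operator f <-> continuous f.
Proof.
split=> [[c c0 fc]|fcont].
  apply/linear_bounded_continuous/linear_boundedP.
  exists c; split; first exact: ger0_real.
  by move=> r cr x; rewrite (le_trans (fc x))// ler_wpM2r// ltW.
have /linear_boundedP := proj2 (linear_bounded_continuous f) fcont.
move=> [M [Mreal Mf]]; exists (`|M| + 1); first by rewrite addr_ge0.
by apply: Mf; rewrite (le_lt_trans (real_ler_norm Mreal))// ltrDl.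
Qed.

Lemma opp_linear (T : operator) : linear (fun x => - T x).
Proof. by move=> a x y; rewrite linearP opprD scalerN. Qed.

Lemma add_linear (S T : operator) : linear (fun x => S x + T x).
Proof. by move=> a x y; rewrite !linearP scalerDr addrACA. Qed.

Lemma comp_linear (S T : operator) : linear (S \o T).
Proof. by move=> a x y; rewrite /= !linearP. Qed.

Lemma zero_bounded : bounded_operator (fun=> 0).
Proof. by exists 0 => // x; rewrite normr0 mul0r. Qed.

Lemma id_bounded : bounded_operator id.
Proof. by exists 1 => // x; rewrite mul1r. Qed.

Lemma opp_bounded (T : operator) : bounded_operator (fun x => - T x).
Proof.
by have [c c0 Tc] := operator_bounded T; exists c => // x; rewrite normrN.
Qed.

Lemma add_bounded (S T : operator) : bounded_operator (fun x => S x + T x).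
Proof.
have [c c0 Sc] := operator_bounded S; have [d d0 Td] := operator_bounded T.
exists (c + d) => [|x]; first exact: addr_ge0.
by rewrite mulrDl (le_trans (ler_normD _ _))// lerD.
Qed.

Lemma comp_bounded (S T : operator) : bounded_operator (S \o T).
Proof.
have [c c0 Sc] := operator_bounded S; have [d d0 Td] := operator_bounded T.
exists (c * d) => [|x /=]; first exact: mulr_ge0.
by rewrite (le_trans (Sc _))// -mulrA ler_wpM2l.
Qed.

Lemma zero_linear : linear (fun _ : X => 0 : X).
Proof. by move=> a x y; rewrite scaler0 addr0. Qed.

Lemma id_linear : linear (@id X).
Proof. by []. Qed.

Definition operator0 := Operator zero_linear zero_bounded.
Definition operator1 := Operator id_linear id_bounded.
Definition operator_opp T := Operator (opp_linear T) (opp_bounded T).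
Definition operator_add S T := Operator (add_linear S T) (add_bounded S T).
Definition operator_mul S T := Operator (comp_linear S T) (comp_bounded S T).

Lemma operator_addA : associative operator_add.
Proof. by move=> S T U; apply: operatorP => x /=; rewrite addrA. Qed.

Lemma operator_addC : commutative operator_add.
Proof. by move=> S T; apply: operatorP => x /=; rewrite addrC. Qed.

Lemma operator_add0 : left_id operator0 operator_add.
Proof. by move=> T; apply: operatorP => x /=; rewrite add0r. Qed.

Lemma operator_addN : left_inverse operator0 operator_opp operator_add.
Proof. by move=> T; apply: operatorP => x /=; rewrite addNr. Qed.

HB.instance Definition _ := GRing.isZmodule.Build operator
  operator_addA operator_addC operator_add0 operator_addN.

Lemma operator_mulA : associative operator_mul.
Proof. by move=> S T U; exact: operatorP. Qed.

Lemma operator_mul1 : left_id operator1 operator_mul.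
Proof. by move=> T; exact: operatorP. Qed.

Lemma operator_mulr1 : right_id operator1 operator_mul.
Proof. by move=> T; exact: operatorP. Qed.

Lemma operator_mulDl : left_distributive operator_mul +%R.
Proof. by move=> S T U; exact: operatorP. Qed.

Lemma operator_mulDr : right_distributive operator_mul +%R.
Proof. by move=> S T U; apply: operatorP => x /=; rewrite linearD. Qed.

(* A [pzRingType] and not a [nzRingType], since X may be the zero space. *)
HB.instance Definition _ := GRing.Zmodule_isPzRing.Build operator
  operator_mulA operator_mul1 operator_mulr1 operator_mulDl operator_mulDr.

Lemma operator_addE (S T : operator) x : (S + T) x = S x + T x.
Proof. by []. Qed.

Lemma operator_mulE (S T : operator) x : (S * T) x = S (T x).
Proof. by []. Qed.

End BoundedOperators.

Notation "''L' ( X )" := (operator X) : type_scope.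

Definition mx2 (R : Type) (A B C D : R) : 'M[R]_2 :=
  \matrix_(i, j) if i == ord0 then (if j == ord0 then A else B)
                 else (if j == ord0 then C else D).

(* Main.v *)
Require Import Defs.
From mathcomp Require Import all_boot all_order all_algebra.
From mathcomp Require Import boolp classical_sets topology normedtype.
Import GRing.Theory.
Local Open Scope ring_scope.

(** Having a Hirano inverse is a polynomial condition: [T] has one iff
    [T - T ^+ 3] is nilpotent ([has_hirano_inverseP]). In this form it is
    stable under sums with a one-sided orthogonality: if [P * Q = 0] and the
    condition holds for [P] and [Q], then it holds for [P + Q]
    ([nil_tripotentD]).

    The hypotheses on the blocks reduce to the vanishing of three products. Since
    [A * A^H + A^pi = 1], the two conditions on [A] say that [B * C = 0]; the
    last condition then becomes [D * D^pi * C = 0], and [B * D^H = 0] gives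
    [B * e = 0] for the idempotent [e := D * D^H]. Cutting [D] into
    [D * (1 - e)] and [D * e] writes the matrix as a sum of five matrices with
    one nonzero block each, holding in this order
      [D * (1 - e)], [B], [A], [C], [D * e],
    and each of them annihilates, from the left, all the later ones: for
    [D * (1 - e)] times [C], [B] times [C] and [B] times [D * e] this is what the
    hypotheses say, the pair [D * (1 - e)], [D * e] is orthogonal, and all other
    products vanish because of the positions of the blocks. The off-diagonal
    terms have square zero, and the diagonal ones inherit the condition from
    [A] and [D], so repeated use of the sum lemma concludes. *)

(** * Nilpotency in noncommutative rings *)

Section HiranoPolynomial.
Variable R : pzRingType.
Implicit Types a b d e p q x y : R.

Lemma nilpotent_mull x y : GRing.comm x y -> nilpotent x -> nilpotent (x * y).
Proof.
by move=> cxy [n xn0]; exists n; rewrite exprMn_comm // xn0 mul0r.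
Qed.

Lemma nilpotent_sqr x : nilpotent (x ^+ 2) -> nilpotent x.
Proof. by move=> [n xn0]; exists (2 * n)%N; rewrite exprM. Qed.

Lemma intertwineX p q x n : p * x = q * p -> p * x ^+ n = q ^+ n * p.
Proof.
move=> pxq; elim: n => [|n IHn]; first by rewrite !expr0 mulr1 mul1r.
by rewrite exprS mulrA pxq -mulrA IHn mulrA -exprS.
Qed.

(** * Elements that are tripotent up to a nilpotent *)

Definition nil_tripotent a : Prop := nilpotent (a - a ^+ 3).

(** With [e := a * z] and [w := a ^+ 2 - e] nilpotent, [a ^+ 2] is an idempotent
    plus a commuting nilpotent, so [a ^+ 2 - a ^+ 4 = w * (1 - 2 e - w)] is a
    multiple of [w], and it divides the square of [a - a ^+ 3]. *)
Lemma nil_tripotent_hirano a z : is_hirano_inverse a z -> nil_tripotent a.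
Proof.
move=> [caz zaz nilw]; apply: nilpotent_sqr.
set w := a ^+ 2 - a * z in nilw.
have ca_e : GRing.comm a (a * z) by rewrite /GRing.comm {1}caz mulrA.
have idem : a * z * (a * z) = a * z by rewrite -mulrA (mulrA z) -zaz.
have cwa : GRing.comm w a.
  by apply/commr_sym/commrB => //; exact/commrX/commr_refl.
have cwe : GRing.comm w (a * z).
  by apply/commr_sym/commrB => //; apply/commrX/commr_sym.
have a2E : a ^+ 2 = a * z + w by rewrite addrC subrK.
clearbody w.
have a2a4 : a ^+ 2 * (1 - a ^+ 2) = w * (1 - a * z - a * z - w).
  rewrite a2E mulrBr mulr1 mulrDl !mulrDr idem -cwe !mulrN mulr1.
  by rewrite !opprD !addrA (addrAC _ w) subrr add0r.
have -> : (a - a ^+ 3) ^+ 2 = w * ((1 - a * z - a * z - w) * (1 - a ^+ 2)).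
  rewrite mulrA -a2a4 -mulrA -expr2 -exprMn_comm.
    by rewrite mulrBr mulr1 -exprS.
  by apply: commrB; [exact: commr1 | exact/commrX/commr_refl].
apply: nilpotent_mull nilw; apply: commrM.
  by do 3?[apply: commrB => //]; exact: commr1.
by apply: commrB; [exact: commr1 | exact: commrX].
Qed.

(** For [b := a ^+ 2], nilpotency of [a - a ^+ 3] gives
    [b ^+ n * (1 - b) ^+ n = 0]. Hence [e := 1 - (1 - b ^+ n) ^+ n] is an
    idempotent polynomial in [b], because [b ^+ n] divides [e] and
    [(1 - b) ^+ n] divides [1 - e]. As [a] divides [e], say [e = a * y], the
    element [y * e] inverts [a] on the range of [e]. Finally [b - e] is
    nilpotent: the polynomial [X - e(X)] vanishes at 0 and at 1, so [b - e] is
    a multiple of [b * (1 - b)]. *)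
Lemma nil_tripotent_has_hirano a : nil_tripotent a -> has_hirano_inverse a.
Proof.
move=> [n0 nil0]; pose n := n0.+1.
have niln : (a - a ^+ 3) ^+ n = 0 by rewrite (exprS _ n0) nil0 mulr0.
(* The geometric sums [G] and [H] are the cofactors that witness
   [1 - b] dividing [1 - b ^+ n] and [b ^+ n] dividing [e]. *)
pose b := a ^+ 2; pose G := \sum_(i < n) b ^+ i.
pose H := \sum_(i < n) (1 - b ^+ n) ^+ i.
pose e := 1 - (1 - b ^+ n) ^+ n.
have ca_b : GRing.comm a b by exact/commrX/commr_refl.
have ca_1b : GRing.comm a (1 - b) by apply: commrB => //; exact: commr1.
have ca_1bn : GRing.comm a (1 - b ^+ n).
  by apply: commrB; [exact: commr1 | exact: commrX].
have com_b x : GRing.comm a x -> GRing.comm b x.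
  by move=> /commr_sym /(commrX 2) /commr_sym.
have ca_G : GRing.comm a G by apply: commr_sum => i _; exact: commrX.
have ca_H : GRing.comm a H by apply: commr_sum => i _; exact: commrX.
have ca_e : GRing.comm a e by apply: commrB; [exact: commr1 | exact: commrX].
have bnG : 1 - b ^+ n = (1 - b) * G.
  by rewrite -[LHS]opprB subrX1 -mulNr opprB.
have eH : e = b ^+ n * H.
  rewrite /e -[LHS]opprB subrX1 -mulNr opprB; congr (_ * _).
  by rewrite opprB addrC subrK.
have cG_1b : GRing.comm (1 - b) G.
  by apply/commr_sym/commrB; [exact: commr1 | exact/commr_sym/com_b].
have e'G : 1 - e = (1 - b) ^+ n * G ^+ n.
  by rewrite /e opprB addrC subrK bnG exprMn_comm.
have bn0 : b ^+ n * (1 - b) ^+ n = 0.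
  rewrite -exprMn_comm; last exact: com_b.
  have -> : b * (1 - b) = (a - a ^+ 3) * a.
    by rewrite mulrBr mulr1 mulrBl -exprSr -!expr2 /b -exprM.
  rewrite exprMn_comm ?niln ?mul0r //.
  by apply/commr_sym/commrB; [exact: commr_refl | exact/commrX/commr_refl].
have cb_H : GRing.comm b H by exact: com_b.
have ee' : e * (1 - e) = 0.
  have cbn_H : b ^+ n * H = H * b ^+ n by apply/commr_sym/commrX/commr_sym.
  by rewrite e'G eH cbn_H mulrA -(mulrA H) bn0 mulr0 mul0r.
have idem : e * e = e by move/eqP: ee'; rewrite mulrBr mulr1 subr_eq0 => /eqP.
(* [n] is positive, so one factor [b] and one factor [a] split off [b ^+ n]. *)
pose y := a * (b ^+ n0 * H).
have ca_y : GRing.comm a y.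
  by apply: commrM; [exact: commr_refl | apply: commrM => //; exact: commrX].
have e_ay : e = a * y by rewrite eH exprS /y !mulrA -expr2.
have ay_e : a * (y * e) = e by rewrite mulrA -e_ay idem.
have ye_a : y * e * a = e by rewrite -mulrA -ca_e mulrA -ca_y -e_ay.
exists (y * e); split; first by rewrite ay_e ye_a.
  rewrite ye_a; have cye : GRing.comm y e.
    by rewrite e_ay; apply: commrM; [exact/commr_sym | exact: commr_refl].
  by rewrite cye mulrA idem.
rewrite ay_e -/b; pose w := b ^+ n0 * H; pose v := G * (1 - b ^+ n) ^+ n0.
have e_bw : e = b * w by rewrite eH exprS mulrA.
have e'_bv : 1 - e = (1 - b) * v.
  by rewrite /e opprB addrC subrK exprS {1}bnG mulrA.
have ca_vw : GRing.comm a (v - w).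
  by apply: commrB; apply: commrM => //; exact: commrX.
clearbody w v e.
have -> : b - e = b * (1 - b) * (v - w).
  rewrite mulrBr -mulrA -e'_bv.
  rewrite (_ : b * (1 - b) * w = (1 - b) * e); last first.
    by rewrite e_bw mulrA (com_b _ ca_1b).
  rewrite mulrBr mulr1 mulrBl mul1r e_bw.
  by rewrite opprB addrA subrK.
apply: nilpotent_mull; last by exists n; rewrite exprMn_comm //; exact: com_b.
apply/commr_sym/commrM; first exact/commr_sym/com_b.
by apply: commrB; [exact: commr1 | exact/commr_sym/com_b].
Qed.

Lemma has_hirano_inverseP a : has_hirano_inverse a <-> nil_tripotent a.
Proof.
by split=> [[z /nil_tripotent_hirano]|]; last exact: nil_tripotent_has_hirano.
Qed.

(** Put [x := p + q] and [f t := t - t ^+ 3]. From [p * x = p * p] and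
    [x * q = q * q], the element [p] intertwines [f x] with [f p], and [q] does
    so with [f q], whence [f x ^+ m * p * f x ^+ n = f x ^+ m * q * f x ^+ n = 0]
    for suitable [m] and [n]. The sum of these is [f x ^+ m * x * f x ^+ n],
    and [x] divides [f x]. *)
Lemma nil_tripotentD p q :
  p * q = 0 -> nil_tripotent p -> nil_tripotent q -> nil_tripotent (p + q).
Proof.
move=> pq0 [n pn0] [m qm0]; set x := p + q.
have px : p * x = p * p by rewrite mulrDr pq0 addr0.
have xq : q * q = x * q by rewrite mulrDl pq0 add0r.
have pf : p * (x - x ^+ 3) = (p - p ^+ 3) * p.
  by rewrite mulrBr mulrBl px (intertwineX _ _ _ _ px).
have fq : q * (q - q ^+ 3) = (x - x ^+ 3) * q.
  by rewrite mulrBr mulrBl xq (intertwineX _ _ _ _ xq).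
have pfn : p * (x - x ^+ 3) ^+ n = 0 by rewrite (intertwineX _ _ _ _ pf) pn0 mul0r.
have fqm : (x - x ^+ 3) ^+ m * q = 0 by rewrite -(intertwineX _ _ _ _ fq) qm0 mulr0.
have xfn : x * (x - x ^+ 3) ^+ n = q * (x - x ^+ 3) ^+ n.
  by rewrite {1}/x mulrDl pfn add0r.
have fxE : x - x ^+ 3 = (1 - x ^+ 2) * x by rewrite mulrBl mul1r -exprSr.
exists (m + n.+1)%N; rewrite exprD (exprS _ n) {2}fxE !mulrA.
have -> : (x - x ^+ 3) ^+ m * (1 - x ^+ 2) = (1 - x ^+ 2) * (x - x ^+ 3) ^+ m.
  apply/commr_sym/commrX; apply/commr_sym; apply: commrB; first exact: commr1.
  apply/commrX/commr_sym/commrB; first exact: commr_refl.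
  exact/commrX/commr_refl.
by rewrite -!mulrA xfn (mulrA _ q) fqm mul0r mulr0.
Qed.

Lemma nil_tripotent_sqr0 a : a ^+ 2 = 0 -> nil_tripotent a.
Proof. by move=> a20; exists 2%N; rewrite (exprS a 2) a20 mulr0 subr0. Qed.

Lemma nil_tripotent_corner d e :
  GRing.comm d e -> e * e = e -> nil_tripotent d -> nil_tripotent (d * e).
Proof.
move=> cde ee nild; rewrite /nil_tripotent.
have -> : d * e - (d * e) ^+ 3 = (d - d ^+ 3) * e.
  have e3 : e ^+ 3 = e by rewrite !exprS expr0 mulr1 !ee.
  by rewrite exprMn_comm // mulrBl e3.
apply: nilpotent_mull nild; apply/commr_sym/commrB; first exact: commr_sym.
exact/commrX/commr_sym.
Qed.

End HiranoPolynomial.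

Arguments nil_tripotent {R} a.

(** * Two-by-two matrices *)

Section Blocks.
Variable R : pzRingType.
Implicit Types A B C D : R.

Lemma mx2D A B C D A' B' C' D' :
  mx2 A B C D + mx2 A' B' C' D' = mx2 (A + A') (B + B') (C + C') (D + D').
Proof. by apply/matrixP => i j; rewrite !mxE; do 2?case: ifP. Qed.

Lemma mx2N A B C D : - mx2 A B C D = mx2 (- A) (- B) (- C) (- D).
Proof. by apply/matrixP => i j; rewrite !mxE; do 2?case: ifP. Qed.

Lemma mx2M A B C D A' B' C' D' : mx2 A B C D * mx2 A' B' C' D' =
  mx2 (A * A' + B * C') (A * B' + B * D') (C * A' + D * C') (C * B' + D * D').
Proof.
apply/matrixP => i j; rewrite !mxE !big_ord_recl big_ord0 addr0 !mxE /=.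
by do 2?case: ifP.
Qed.

Lemma mx2_0 : mx2 0 0 0 0 = 0 :> 'M[R]_2.
Proof. by apply/matrixP => i j; rewrite !mxE; do 2?case: ifP. Qed.

Lemma mx2_ulX A n : mx2 A 0 0 0 ^+ n.+1 = mx2 (A ^+ n.+1) 0 0 0.
Proof.
elim: n => [|n IHn]; first by rewrite !expr1.
by rewrite exprS IHn mx2M !(mulr0, mul0r, addr0) -exprS.
Qed.

Lemma mx2_drX D n : mx2 0 0 0 D ^+ n.+1 = mx2 0 0 0 (D ^+ n.+1).
Proof.
elim: n => [|n IHn]; first by rewrite !expr1.
by rewrite exprS IHn mx2M !(mulr0, mul0r, add0r) -exprS.
Qed.

Lemma nil_tripotent_ul A : nil_tripotent A -> nil_tripotent (mx2 A 0 0 0).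
Proof.
move=> [n nilA]; exists n.+1.
by rewrite mx2_ulX mx2N mx2D !subr0 mx2_ulX (exprS _ n) nilA mulr0 mx2_0.
Qed.

Lemma nil_tripotent_dr D : nil_tripotent D -> nil_tripotent (mx2 0 0 0 D).
Proof.
move=> [n nilD]; exists n.+1.
by rewrite mx2_drX mx2N mx2D !subr0 mx2_drX (exprS _ n) nilD mulr0 mx2_0.
Qed.

(** The idempotent [e] stands for [D * D^H]. The five summands are associated to
    the right, so that each use of the sum lemma splits off the first one, which
    annihilates the sum of all the others. *)
Lemma nil_tripotent_mx2 A B C D e :
  nil_tripotent A -> nil_tripotent D -> GRing.comm D e -> e * e = e ->
  B * e = 0 -> B * C = 0 -> D * (1 - e) * C = 0 ->
  nil_tripotent (mx2 A B C D).
Proof.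
move=> nilA nilD cDe ee Be0 BC0 De'C0.
have e'e : (1 - e) * e = 0 by rewrite mulrBl mul1r ee subrr.
have -> : mx2 A B C D = mx2 0 0 0 (D * (1 - e)) + (mx2 0 B 0 0 +
    (mx2 A 0 0 0 + (mx2 0 0 C 0 + mx2 0 0 0 (D * e)))).
  by rewrite !mx2D !(add0r, addr0) -mulrDr subrK mulr1.
have BDe0 : B * (D * e) = 0 by rewrite cDe mulrA Be0 mul0r.
have De'De0 : D * (1 - e) * (D * e) = 0.
  by rewrite cDe -!mulrA (mulrA _ e) e'e mul0r mulr0.
do ?[apply: nil_tripotentD;
  first by rewrite ?mx2D mx2M !(add0r, addr0, mul0r, mulr0) ?BC0 ?BDe0 ?De'C0
    ?De'De0 mx2_0].
- apply: nil_tripotent_dr; apply: nil_tripotent_corner nilD.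
    by apply: commrB => //; exact: commr1.
  by rewrite mulrBr mulr1 e'e subr0.
- by apply: nil_tripotent_sqr0; rewrite expr2 mx2M !(addr0, mul0r, mulr0) mx2_0.
- exact: nil_tripotent_ul.
- by apply: nil_tripotent_sqr0; rewrite expr2 mx2M !(addr0, mul0r, mulr0) mx2_0.
- exact/nil_tripotent_dr/nil_tripotent_corner.
Qed.

End Blocks.

Theorem theorem3p4 (K : numFieldType) (X : completeNormedModType K)
    (A B C D : 'L(X)) :
  has_hirano_inverse A ->
  has_hirano_inverse D ->
  B * hirano_inverse D = 0 ->
  spectral_idempotent A * B * C = 0 ->
  hirano_inverse A * B * C = 0 ->
  (D * spectral_idempotent D - C * hirano_inverse A * B) * C = 0 ->
  has_hirano_inverse (mx2 A B C D).
Proof.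
move=> hA hD BDH ApBC AHBC last0.
have BC0 : B * C = 0.
  move: ApBC; rewrite /spectral_idempotent drazin_inverse_hirano //.
  by rewrite mulrBl mul1r mulrBl -!mulrA (mulrA _ B) AHBC mulr0 subr0.
have DDpC0 : D * spectral_idempotent D * C = 0.
  by move: last0; rewrite mulrBl -(mulrA _ B) BC0 mulr0 subr0.
move: DDpC0; rewrite /spectral_idempotent drazin_inverse_hirano // => DDpC0.
have [Z hZ] := hD; have DHE := hirano_inverseE hZ; have [cDZ ZDZ _] := hZ.
rewrite {}DHE in BDH DDpC0.
apply/has_hirano_inverseP; apply: (@nil_tripotent_mx2 _ _ _ _ _ (D * Z)) => //.
- exact/has_hirano_inverseP.
- exact/has_hirano_inverseP.
- by rewrite /GRing.comm {1}cDZ mulrA.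
- by rewrite -mulrA (mulrA Z) -ZDZ.
- by rewrite cDZ mulrA BDH mul0r.
Qed.
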